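(* Let $\alpha = \{ \alpha_g : R_{g^{-1}} \rightarrow R_g \}_{g \in \mathrm{mor}(G)}$ be a unital partial action of a groupoid $G$ on an associative ring $R$. If $\mathrm{mor}(G)$ is finite, $R$ is semisimple and $\mathrm{tr}_\alpha(1_R)$ is invertible in $R$, then the partial skew groupoid ring $R\star_\alpha G$ is semisimple.
   Context: A ring is simple if $\{0\}$ and the ring itself are its only (two-sided) ideals; a ring is semisimple if it is a finite direct sum of simple rings. A groupoid $G$ is a small category in which all morphisms are isomorphisms, with objects $\mathrm{ob}(G)$ identified with identity morphisms, so $\mathrm{ob}(G)\subseteq\mathrm{mor}(G)$; $d(g)$, $c(g)$ are the domain and codomain of $g$, and $G^2$ is the set of pairs $(g,h)$ with $d(g)=c(h)$. A partial action of $G$ on $R$ is a family $\alpha = \{ \alpha_g : R_{g^{-1}} \to R_g \}_{g \in \mathrm{mor}(G)}$ such that for each $g$, $R_{c(g)}$ is an ideal of $R$, $R_g$ is an ideal of $R_{c(g)}$, $\alpha_g$ is a ring isomorphism, and: (P1) $\alpha_e=\mathrm{id}_{R_e}$ for $e\in\mathrm{ob}(G)$; (P2) if $(g,h)\in G^2$ then $R_{(gh)^{-1}}\supseteq \alpha_h^{-1}(R_h\cap R_{g^{-1}})$; (P3) if $(g,h)\in G^2$ and $x\in\alpha_h^{-1}(R_h\cap R_{g^{-1}})$ then $\alpha_g(\alpha_h(x))=\alpha_{gh}(x)$; (P4) $R=\bigoplus_{e\in\mathrm{ob}(G)}R_e$. It is unital if every non-zero $R_g$ is a unital ring; $1_g$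 denotes the identity of $R_g$ (with $1_g=0$ if $R_g=\{0\}$). When $\mathrm{ob}(G)$ is finite, $R$ has identity $1_R=\sum_{e\in\mathrm{ob}(G)}1_e$. If $\mathrm{mor}(G)$ is finite, the trace map is $\mathrm{tr}_\alpha : R\to R^\alpha$, $\mathrm{tr}_\alpha(x)=\sum_{g\in\mathrm{mor}(G)}\alpha_g(x1_{g^{-1}})$, where $R^\alpha=\{x\in R : \alpha_g(x1_{g^{-1}})=x1_g \text{ for all } g\in \mathrm{mor}(G)\}$. The partial skew groupoid ring $R\star_\alpha G$ is the set of finite formal sums $\sum_{g\in\mathrm{mor}(G)} r_g\delta_g$ with $r_g\in R_g$, with componentwise addition and multiplication determined by $(r_g\delta_g)(r'_h\delta_h)=\alpha_g(\alpha_{g^{-1}}(r_g)r'_h)\delta_{gh}$ if $(g,h)\in G^2$, and $0$ otherwise. *)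

(* Defs.v *)
From HB Require Import structures.
From mathcomp Require Import all_boot all_algebra.
From mathcomp Require Import boolp classical_sets functions.

Set Implicit Arguments.
Unset Strict Implicit.
Unset Printing Implicit Defensive.

Import GRing.Theory.

Local Open Scope classical_set_scope.
Local Open Scope ring_scope.

Section Rings.
Variable R : pzRingType.
Implicit Types A I J : set R.

(* I is a two-sided ideal of A, where A is a (not necessarily unital) subring
   of R. *)
Definition is_ideal A I : Prop :=
  [/\ I `<=` A, I 0, forall x y, I x -> I y -> I (x - y)
    & forall a x, A a -> I x -> I (a * x) /\ I (x * a)].

(* A = 0 is not excluded; zero summands do not affect semisimplicity. *)
Definition is_simple A : Prop :=
  forall I, is_ideal A I -> I = [set 0] \/ I = A.

(* R is the internal direct sum of the additive subgroups A i with P i. *)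
Definition is_direct_sum (T : finType) (P : pred T) (A : T -> set R) : Prop :=
  (forall x, exists2 y : T -> R,
     (forall i, P i -> A i (y i)) & x = \sum_(i | P i) y i)
  /\ (forall y z : T -> R,
        (forall i, P i -> A i (y i)) -> (forall i, P i -> A i (z i)) ->
        \sum_(i | P i) y i = \sum_(i | P i) z i ->
        forall i, P i -> y i = z i).

Definition is_identity A (u : R) : Prop :=
  A u /\ forall x, A x -> u * x = x /\ x * u = x.

Definition is_invertible (x : R) : Prop :=
  exists y, x * y = 1 /\ y * x = 1.

End Rings.

(* The summands of a finite direct sum of rings are ideals of the sum, so the
   sum is taken internally. *)
Definition is_semisimple (R : pzRingType) : Prop :=
  exists n (A : 'I_n -> set R),
    [/\ forall i, is_ideal setT (A i), forall i, is_simple (A i)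
      & is_direct_sum xpredT A].

(* A groupoid with finitely many morphisms. The elements are the morphisms;
   objects are identified with their identity morphisms. The composite
   gcomp g h is meaningful only if gdom g = gcod h. *)
Record finGroupoid := FinGroupoid {
  mor :> finType;
  gdom : mor -> mor;
  gcod : mor -> mor;
  gcomp : mor -> mor -> mor;
  ginv : mor -> mor;
  gdom_gdom : forall g, gdom (gdom g) = gdom g;
  gcod_gdom : forall g, gcod (gdom g) = gdom g;
  gdom_gcod : forall g, gdom (gcod g) = gcod g;
  gcod_gcod : forall g, gcod (gcod g) = gcod g;
  gdom_gcomp : forall g h, gdom g = gcod h -> gdom (gcomp g h) = gdom h;
  gcod_gcomp : forall g h, gdom g = gcod h -> gcod (gcomp g h) = gcod g;
  gcompA : forall g h k, gdom g = gcod h -> gdom h = gcod k ->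
    gcomp g (gcomp h k) = gcomp (gcomp g h) k;
  gcomp_gdom : forall g, gcomp g (gdom g) = g;
  gcomp_gcod : forall g, gcomp (gcod g) g = g;
  gdom_ginv : forall g, gdom (ginv g) = gcod g;
  gcod_ginv : forall g, gcod (ginv g) = gdom g;
  gcompgV : forall g, gcomp g (ginv g) = gcod g;
  gcompVg : forall g, gcomp (ginv g) g = gdom g
}.

Definition ob (G : finGroupoid) : pred G := fun e => gdom e == e.

(* pideal g is R_g. The isomorphism alpha_g : R_{g^-1} -> R_g is represented by
   a function pact g on R whose values outside of R_{g^-1} are irrelevant. *)
Record partialAction (G : finGroupoid) (R : pzRingType) := PartialAction {
  pideal : G -> set R;
  pact : G -> R -> R;
  pideal_gcod : forall g, is_ideal setT (pideal (gcod g));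
  pideal_ideal : forall g, is_ideal (pideal (gcod g)) (pideal g);
  pact_bij : forall g, set_bij (pideal (ginv g)) (pideal g) (pact g);
  pactD : forall g x y, pideal (ginv g) x -> pideal (ginv g) y ->
    pact g (x + y) = pact g x + pact g y;
  pactM : forall g x y, pideal (ginv g) x -> pideal (ginv g) y ->
    pact g (x * y) = pact g x * pact g y;
  pact_ob : forall e, ob e -> forall x, pideal e x -> pact e x = x;
  pideal_gcomp : forall g h, gdom g = gcod h ->
    pideal (ginv h) `&` pact h @^-1` (pideal h `&` pideal (ginv g))
      `<=` pideal (ginv (gcomp g h));
  pact_gcomp : forall g h, gdom g = gcod h -> forall x,
    (pideal (ginv h) `&` pact h @^-1` (pideal h `&` pideal (ginv g))) x ->
    pact g (pact h x) = pact (gcomp g h) x;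
  pideal_sum : is_direct_sum (@ob G) pideal
}.

Definition unital (G : finGroupoid) (R : pzRingType)
    (alpha : partialAction G R) : Prop :=
  forall g, pideal alpha g <> [set 0] -> exists u, is_identity (pideal alpha g) u.

Record unitalPartialAction (G : finGroupoid) (R : pzRingType) :=
  UnitalPartialAction {
    upact :> partialAction G R;
    upactP : unital upact
  }.

(* The identity 1_g of R_g; it is 0 if R_g = 0. *)
Definition pone (G : finGroupoid) (R : pzRingType) (alpha : partialAction G R)
    (g : G) : R :=
  xget 0 [set u | is_identity (pideal alpha g) u].

Definition trace (G : finGroupoid) (R : pzRingType) (alpha : partialAction G R)
    (x : R) : R :=
  \sum_(g : G) pact alpha g (x * pone alpha (ginv g)).

(* As G has finitely many morphisms, an element of the partial skew groupoid
   ring is any family r with r g in R_g, representing sum_g r_g delta_g. *)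
Section SkewGroupoidRing.
Variables (G : finGroupoid) (R : pzRingType) (alpha : unitalPartialAction G R).

Definition skew_pred : {pred {ffun G -> R}} :=
  fun r => `[< forall g, pideal alpha g (r g) >].

Record skewRing := SkewRing {
  skew_val :> {ffun G -> R};
  skew_valP : skew_val \in skew_pred
}.

HB.instance Definition _ := [isSub for skew_val].
HB.instance Definition _ := [Choice of skewRing by <:].

Local Notation D := (pideal alpha).
Local Notation act := (pact alpha).
Local Notation one_ := (pone alpha).

Lemma pideal0 g : D g 0.
Proof. by case: (pideal_ideal alpha g). Qed.

Lemma pidealB g x y : D g x -> D g y -> D g (x - y).
Proof. by case: (pideal_ideal alpha g) => _ _ h _; apply: h. Qed.

Fact skew_zmod_closed : zmod_closed skew_pred.
Proof.
split=> [|r s /asboolP rP /asboolP sP]; apply/asboolP=> g; rewrite !ffunE.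
  exact: pideal0.
exact: pidealB.
Qed.

HB.instance Definition _ :=
  GRing.isZmodClosed.Build {ffun G -> R} skew_pred skew_zmod_closed.
HB.instance Definition _ := [SubChoice_isSubZmodule of skewRing by <:].

Lemma pidealN g x : D g x -> D g (- x).
Proof. by move=> Dx; rewrite -sub0r; apply: pidealB => //; apply: pideal0. Qed.

Lemma pidealD g x y : D g x -> D g y -> D g (x + y).
Proof. by move=> Dx Dy; rewrite -[y]opprK; apply/pidealB/pidealN. Qed.

Lemma pideal_sumr g (I : finType) (P : pred I) (F : I -> R) :
  (forall i, P i -> D g (F i)) -> D g (\sum_(i | P i) F i).
Proof.
by move=> FP; apply: (big_ind (D g)) => //;
  [exact: pideal0 | exact: pidealD].
Qed.

Lemma pideal_cod g x : D g x -> D (gcod g) x.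
Proof. by case: (pideal_ideal alpha g) => h _ _ _; apply: h. Qed.

Lemma pone_id g : is_identity (D g) (one_ g).
Proof.
rewrite /pone; apply: xgetPex.
have [D0|/upactP//] := pselect (D g = [set 0]).
by exists 0; rewrite D0; split=> // x ->; rewrite mul0r.
Qed.

Lemma ponein g : D g (one_ g). Proof. by case: (pone_id g). Qed.
Lemma mul1p g x : D g x -> one_ g * x = x.
Proof. by case: (pone_id g) => _ h /h[]. Qed.
Lemma mulp1 g x : D g x -> x * one_ g = x.
Proof. by case: (pone_id g) => _ h /h[]. Qed.

Lemma pidealT g : is_ideal setT (D g).
Proof.
have [hc _ hB hM] := pideal_ideal alpha g.
have [_ _ _ hT] := pideal_gcod alpha g.
split=> //; first exact: pideal0.
move=> a x _ Dx; split.
  rewrite -(mul1p Dx) mulrA; apply: (hM _ _ _ Dx).1.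
  exact: (hT a _ I (pideal_cod (ponein g))).1.
rewrite -(mulp1 Dx) -mulrA; apply: (hM _ _ _ Dx).2.
exact: (hT a _ I (pideal_cod (ponein g))).2.
Qed.

Lemma pidealMl g a x : D g x -> D g (a * x).
Proof. by case: (pidealT g) => _ _ _ h Dx; apply: (h a x I Dx).1. Qed.
Lemma pidealMr g x a : D g x -> D g (x * a).
Proof. by case: (pidealT g) => _ _ _ h Dx; apply: (h a x I Dx).2. Qed.

Lemma pone_central g x : x * one_ g = one_ g * x.
Proof.
by rewrite -(mul1p (pidealMl x (ponein g))) mulrA (mulp1 (pidealMr x (ponein g))).
Qed.

Lemma ginvK (g : G) : ginv (ginv g) = g.
Proof.
rewrite -(gcomp_gdom (ginv (ginv g))) gdom_ginv gcod_ginv -(gcompVg g).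
rewrite gcompA ?gdom_ginv ?gcod_ginv //.
by rewrite gcompVg gdom_ginv gcomp_gcod.
Qed.

Lemma pact_in g x : D (ginv g) x -> D g (act g x).
Proof. by case: (pact_bij alpha g) => h _ _ Dx; apply: h. Qed.

Lemma pactV_in g x : D g x -> D (ginv g) (act (ginv g) x).
Proof. by move=> Dx; apply: pact_in; rewrite ginvK. Qed.

Lemma pactK g x : D (ginv g) x -> act (ginv g) (act g x) = x.
Proof.
move=> Dx; rewrite pact_gcomp ?gdom_ginv //; last first.
  by split=> //; split; rewrite ?ginvK; apply: pact_in.
rewrite gcompVg pact_ob //; first by rewrite /ob gdom_gdom.
by rewrite -gcod_ginv; apply: pideal_cod.
Qed.

Lemma pactVK g x : D g x -> act g (act (ginv g) x) = x.
Proof. by move=> Dx; rewrite -{1}(ginvK g) pactK // ginvK. Qed.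

Lemma pact0 g : act g 0 = 0.
Proof.
apply: (addrI (act g 0)); rewrite -pactD ?addr0 //; exact: pideal0.
Qed.

Definition smul (g : G) (r s : R) : R := act g (act (ginv g) r * s).

Lemma smul_in g h r s :
  gdom g = gcod h -> D g r -> D h s -> D (gcomp g h) (smul g r s).
Proof.
move=> gh Dr Ds; rewrite /smul; set x := _ * s.
have Dx : D (ginv g) x by apply/pidealMr/pactV_in.
have Dhx : D h x by apply: pidealMl.
pose z := act (ginv h) x.
have Dz : D (ginv h) z by apply: pactV_in.
have zE : act h z = x by rewrite pactVK.
rewrite -zE pact_gcomp //; last by rewrite /= zE.
apply: pact_in; apply: pideal_gcomp => //; split=> //=.
by rewrite zE.
Qed.

Lemma smulDl g r r' s : D g r -> D g r' ->
  smul g (r + r') s = smul g r s + smul g r' s.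
Proof.
move=> Dr Dr'; rewrite /smul pactD ?ginvK // mulrDl.
by rewrite pactD //; apply/pidealMr/pactV_in.
Qed.

Lemma smulDr g r s s' : D g r -> smul g r (s + s') = smul g r s + smul g r s'.
Proof.
by move=> Dr; rewrite /smul mulrDr pactD //; apply/pidealMr/pactV_in.
Qed.

Lemma smul0l g s : smul g 0 s = 0.
Proof. by rewrite /smul pact0 mul0r pact0. Qed.

Lemma smul0r g r : smul g r 0 = 0.
Proof. by rewrite /smul mulr0 pact0. Qed.

Lemma smul_suml g (I : finType) (P : pred I) (F : I -> R) s :
  (forall i, P i -> D g (F i)) ->
  smul g (\sum_(i | P i) F i) s = \sum_(i | P i) smul g (F i) s.
Proof.
move=> FP.
suff [//] : smul g (\sum_(i | P i) F i) s = \sum_(i | P i) smul g (F i) s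
  /\ D g (\sum_(i | P i) F i).
apply: (big_ind2 (fun x y => smul g x s = y /\ D g x)).
- by rewrite smul0l; split=> //; apply: pideal0.
- move=> x _ y _ [<- Dx] [<- Dy]; rewrite smulDl //.
  by split=> //; apply: pidealD.
- by move=> i /FP.
Qed.

Lemma smul_sumr g (I : finType) (P : pred I) (F : I -> R) r : D g r ->
  smul g r (\sum_(i | P i) F i) = \sum_(i | P i) smul g r (F i).
Proof.
move=> Dr; apply: (big_morph (smul g r)); last exact: smul0r.
by move=> x y; apply: smulDr.
Qed.

Lemma smulA g h r s t : gdom g = gcod h -> D g r -> D h s ->
  smul g r (smul h s t) = smul (gcomp g h) (smul g r s) t.
Proof.
move=> gh Dr Ds; rewrite /smul.
set r' := act (ginv g) r; set s' := act (ginv h) s.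
have Dr' : D (ginv g) r' by apply: pactV_in.
have Ds' : D (ginv h) s' by apply: pactV_in.
pose t' := one_ (ginv h) * t.
have Dt' : D (ginv h) t' by apply/pidealMr/ponein.
have tE x : D (ginv h) x -> x * t = x * t'.
  by move=> Dx; rewrite mulrA mulp1.
have sE : act h s' = s by apply: pactVK.
rewrite (tE s') // [act h _]pactM // sE mulrA.
have Dx : D (ginv g) (r' * s) by apply: pidealMr.
have Dhx : D h (r' * s) by apply: pidealMl.
pose z := act (ginv h) (r' * s).
have Dz : D (ginv h) z by apply: pactV_in.
have zE : act h z = r' * s by rewrite pactVK.
have Dghz : D (ginv (gcomp g h)) z.
  by apply: pideal_gcomp => //; split=> //=; rewrite zE.
have -> : act g (r' * s) = act (gcomp g h) z.
  by rewrite -pact_gcomp ?zE //; split=> //=; rewrite zE.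
rewrite pactK // tE // -pact_gcomp //; first by rewrite [act h (z * _)]pactM // zE.
split; first exact: pidealMr.
by rewrite /= pactM // zE; split; apply: pidealMr.
Qed.

(* The bilinear extension of (r delta_g) (s delta_h) = smul g r s delta_(gh) if
   gdom g = gcod h, and 0 otherwise; see skew_mul_delta. *)
Definition skew_mul_val (r s : {ffun G -> R}) : {ffun G -> R} :=
  [ffun k => \sum_(g : G) \sum_(h : G | (gdom g == gcod h) && (gcomp g h == k))
               smul g (r g) (s h)].

Definition skew_one_val : {ffun G -> R} :=
  [ffun g => if ob g then one_ g else 0].

Lemma skewP (r : skewRing) g : D g (r g).
Proof. by case: r => r /= /asboolP. Qed.

Fact skew_mul_in (r s : skewRing) : skew_mul_val r s \in skew_pred.
Proof.
apply/asboolP=> k; rewrite ffunE.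
apply: pideal_sumr => g _; apply: pideal_sumr => h /andP[/eqP gh /eqP <-].
by apply: smul_in => //; apply: skewP.
Qed.

Fact skew_one_in : skew_one_val \in skew_pred.
Proof.
by apply/asboolP=> g; rewrite ffunE; case: ifP => _;
  [exact: ponein | exact: pideal0].
Qed.

Definition skew_mul (r s : skewRing) := SkewRing (skew_mul_in r s).
Definition skew_one := SkewRing skew_one_in.

Lemma skew_mulE (r s : skewRing) k :
  skew_mul r s k =
  \sum_(g : G) \sum_(h : G | (gdom g == gcod h) && (gcomp g h == k))
    smul g (r g) (s h).
Proof. by rewrite /= ffunE. Qed.

Lemma skew_eq (r s : skewRing) : (forall g, r g = s g) -> r = s.
Proof. by move=> rs; apply/val_inj/ffunP. Qed.

Lemma skew_addE (r s : skewRing) g : (r + s) g = r g + s g.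
Proof. by rewrite /= ffunE. Qed.

Lemma big_fiber (f : G -> G) (P Q : pred G) (F : G -> R) :
  \sum_(m | P m) \sum_(k | Q k && (f k == m)) F k =
  \sum_(k | Q k && P (f k)) F k.
Proof.
rewrite (exchange_big_dep Q) /=; last by move=> m k _ /andP[].
rewrite [RHS]big_mkcondr; apply: eq_bigr => k Qk.
rewrite big_mkcond (bigD1 (f k)) //= Qk eqxx.
by rewrite big1 ?addr0 ?andbT // => m /negPf mk; rewrite eq_sym mk !andbF.
Qed.

Fact skew_mulA : associative skew_mul.
Proof.
move=> r s t; apply: skew_eq => l; rewrite !skew_mulE.
transitivity (\sum_(g : G) \sum_(h : G) \sum_(k : G | (gdom h == gcod k) &&
  ((gdom g == gcod (gcomp h k)) && (gcomp g (gcomp h k) == l)))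
    smul g (r g) (smul h (s h) (t k))).
  apply: eq_bigr => g _.
  transitivity (\sum_(m : G | (gdom g == gcod m) && (gcomp g m == l))
    \sum_(h : G) \sum_(k : G | (gdom h == gcod k) && (gcomp h k == m))
       smul g (r g) (smul h (s h) (t k))).
    apply: eq_bigr => m _; rewrite skew_mulE smul_sumr; last exact: skewP.
    by apply: eq_bigr => h _; rewrite smul_sumr //; apply: skewP.
  rewrite exchange_big; apply: eq_bigr => h _.
  by rewrite (big_fiber _ (fun m => (gdom g == gcod m) && (gcomp g m == l))).
transitivity (\sum_(g : G) \sum_(m : G)
  \sum_(h : G | (gdom g == gcod h) && (gcomp g h == m))
  \sum_(k : G | (gdom (gcomp g h) == gcod k) && (gcomp (gcomp g h) k == l))
    smul (gcomp g h) (smul g (r g) (s h)) (t k)); last first.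
  rewrite exchange_big; apply: eq_bigr => m _ /=.
  transitivity (\sum_(g : G)
    \sum_(k : G | (gdom m == gcod k) && (gcomp m k == l))
    \sum_(h : G | (gdom g == gcod h) && (gcomp g h == m))
    smul m (smul g (r g) (s h)) (t k)).
    apply: eq_bigr => g _; rewrite [RHS]exchange_big.
    by apply: eq_bigr => h /andP[_ /eqP ->].
  rewrite exchange_big; apply: eq_bigr => k _ /=.
  have Drs g h : (gdom g == gcod h) && (gcomp g h == m) ->
      D m (smul g (r g) (s h)).
    by case/andP=> /eqP gh /eqP <-; apply: smul_in => //; apply: skewP.
  rewrite skew_mulE smul_suml; last first.
    by move=> g _; apply: pideal_sumr => h; apply: Drs.
  by apply: eq_bigr => g _; rewrite smul_suml // => h; apply: Drs.
apply: eq_bigr => g _.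
rewrite (big_fiber (gcomp g) xpredT (fun h => gdom g == gcod h)).
rewrite [RHS]big_mkcond; apply: eq_bigr => h _; rewrite andbT.
case: eqP => [gh|gh]; last first.
  by rewrite big_pred0 // => k; apply/andP=> -[/eqP hk /andP[/eqP]];
    rewrite gcod_gcomp.
apply: eq_big => [k|k _]; last by rewrite smulA //; apply: skewP.
rewrite gdom_gcomp //; case: eqP => //= hk.
by rewrite gcod_gcomp // gh eqxx gcompA.
Qed.

Fact skew_mul1 : left_id skew_one skew_mul.
Proof.
move=> r; apply: skew_eq => k; rewrite skew_mulE.
rewrite (bigD1 (gcod k)) //= [X in _ + X]big1 => [|e ek].
  rewrite addr0 (bigD1 k) /=; last by rewrite gdom_gcod gcomp_gcod !eqxx.
  rewrite big1 ?addr0 => [|h /andP[/andP[/eqP ch /eqP <-]]].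
    have obk : ob (gcod k) by rewrite /ob gdom_gcod.
    have idk : ginv (gcod k) = gcod k.
      by rewrite -{1}(gcomp_gdom (ginv _)) gdom_ginv gcod_gcod -{3}(gdom_gcod k)
        -(gcompVg (gcod k)).
    rewrite ffunE obk /smul idk (pact_ob obk (ponein _)).
    rewrite pact_ob //; last exact/pidealMr/ponein.
    by rewrite mul1p //; apply/pideal_cod/skewP.
  by rewrite -gdom_gcod ch gcomp_gcod eqxx.
rewrite big1 // => h /andP[/eqP ch /eqP ehk].
rewrite ffunE; case: ifP => [/eqP obe|_]; last by rewrite smul0l.
by move: ek; rewrite -ehk gcod_gcomp // -obe gcod_gdom eqxx.
Qed.

Fact skew_mulr1 : right_id skew_one skew_mul.
Proof.
move=> r; apply: skew_eq => k; rewrite skew_mulE (exchange_big_dep xpredT) //=.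
rewrite (bigD1 (gdom k)) //= [X in _ + X]big1 => [|e ek].
  rewrite addr0 (bigD1 k) /=; last by rewrite gcod_gdom gcomp_gdom !eqxx.
  rewrite big1 ?addr0 => [|h /andP[/andP[/eqP ch /eqP <-]]].
    rewrite ffunE /ob gdom_gdom eqxx /smul mulp1 ?pactVK //; try exact: skewP.
    by rewrite -gcod_ginv; apply/pideal_cod/pactV_in/skewP.
  by rewrite -gcod_gdom -ch gcomp_gdom eqxx.
rewrite big1 // => h /andP[/eqP ch /eqP hek].
rewrite ffunE; case: ifP => [/eqP obe|_]; last by rewrite smul0r.
by move: ek; rewrite -hek gdom_gcomp // obe eqxx.
Qed.

Fact skew_mulDl : left_distributive skew_mul +%R.
Proof.
move=> r r' s; apply: skew_eq => k; rewrite skew_addE !skew_mulE -big_split.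
apply: eq_bigr => g _; rewrite -big_split; apply: eq_bigr => h _ /=.
by rewrite skew_addE smulDl //; apply: skewP.
Qed.

Fact skew_mulDr : right_distributive skew_mul +%R.
Proof.
move=> r s s'; apply: skew_eq => k; rewrite skew_addE !skew_mulE -big_split.
apply: eq_bigr => g _; rewrite -big_split; apply: eq_bigr => h _ /=.
by rewrite skew_addE smulDr //; apply: skewP.
Qed.

HB.instance Definition _ := GRing.Zmodule_isPzRing.Build skewRing
  skew_mulA skew_mul1 skew_mulr1 skew_mulDl skew_mulDr.

Definition delta (g : G) (r : R) : {ffun G -> R} :=
  [ffun k => if k == g then r else 0].

Lemma skew_mul_delta (a b : skewRing) g h r s :
  skew_val a = delta g r -> skew_val b = delta h s ->
  skew_val (a * b) =
  if gdom g == gcod h then delta (gcomp g h) (act g (act (ginv g) r * s)) else 0.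
Proof.
move=> aE bE; apply/ffunP=> k; rewrite [LHS]skew_mulE aE bE.
rewrite (bigD1 g) //= [X in _ + X]big1 => [|i /negPf ig]; last first.
  by rewrite big1 // => j _; rewrite ffunE ig smul0l.
rewrite addr0 big_mkcond (bigD1 h) //= big1 => [|j /negPf jh]; last first.
  by rewrite [delta h s j]ffunE jh smul0r if_same.
by rewrite addr0 !ffunE !eqxx [_ == k]eq_sym; case: eqP; rewrite ?ffunE.
Qed.

(* The identity of R is forced by the axioms of a unital partial action. *)
Lemma sum_pone : \sum_(e : G | ob e) one_ e = 1.
Proof.
have [/(_ 1)[y yD y1] uniq] := pideal_sum alpha.
rewrite y1; apply: eq_bigr => f obf.
have yf : forall e, ob e -> e != f -> y e * one_ f = 0.
  move=> e obe ef; set x := y e * one_ f.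
  have xe : D e x by apply/pidealMr/yD.
  have xf : D f x by apply/pidealMl/ponein.
  have := uniq (fun i => if i == e then x else 0) (fun i => if i == f then x else 0).
  move=> /(_ _ _ _ e obe); rewrite eqxx (negPf ef); apply.
  - by move=> i _; case: eqP => [->|_] //; apply: pideal0.
  - by move=> i _; case: eqP => [->|_] //; apply: pideal0.
  - rewrite (bigD1 e) //= eqxx big1 ?addr0 => [|i /andP[_ /negPf ->] //].
    by rewrite (bigD1 f) //= eqxx big1 ?addr0 => [//|i /andP[_ /negPf ->]].
rewrite -[one_ f]mul1r y1 mulr_suml (bigD1 f) //= big1 ?addr0.
  by rewrite mulp1 //; apply: yD.
by move=> e /andP[]; apply: yf.
Qed.

End SkewGroupoidRing.

(* Main.v *)
(* Put S = R *_alpha G, embed R in S by r |-> sum_e (r 1_e) delta_e, and write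
   u_g = 1_g delta_g. Each u_g normalises R, so every simple summand A of R gives
   an R-subbimodule A u_g of S which is simple or zero, and S is a finite sum of
   these; hence every ideal I of S is the image of an R-bimodule projection f.
   The element sum_g u_g (x) u_{g^-1} commutes with S, so s -> sum_g u_g f(u_{g^-1} s)
   is left S-linear, and on I it is multiplication by the central element
   sum_g u_g u_{g^-1} = tr(1). As tr(1) is invertible, I has a right identity.
   A ring in which all ideals have right identities has all ideals generated by
   central idempotents, and 1 is then a finite sum of orthogonal central
   idempotents generating simple rings. *)
Require Import Defs.
From mathcomp Require Import all_boot all_algebra.
From mathcomp Require Import boolp classical_sets functions.

Set Implicit Arguments.
Unset Strict Implicit.
Unset Printing Implicit Defensive.

Import GRing.Theory.

Local Open Scope classical_set_scope.
Local Open Scope ring_scope.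

(** * Complements and projections for bimodules *)

Section Bimodules.
Variables (S : pzRingType) (B : set S).

(** [B] is only a subset: it will be the image of [R] in the skew ring, or the whole ring when
    ideals are added. *)
Definition is_bimod (W : set S) : Prop :=
  [/\ W 0, forall x y, W x -> W y -> W (x - y)
    & forall b x, B b -> W x -> W (b * x) /\ W (x * b)].

(** The sum [V + W]; writing the second summand as [x - v] leaves a single witness to give. *)
Definition bimod_add (V W : set S) : set S :=
  [set x | exists2 v, V v & W (x - v)].

Lemma bimodD W x y : is_bimod W -> W x -> W y -> W (x + y).
Proof.
by case=> W0 WB _ Wx Wy; rewrite -[y]opprK -[- y]sub0r; apply: (WB) => //; apply: WB.
Qed.

Lemma bimod_sum W (I : finType) (F : I -> S) :
  is_bimod W -> (forall i, W (F i)) -> W (\sum_i F i).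
Proof.
move=> bW WF; apply: (big_ind W) => //; first by case: bW.
by move=> x y; apply: bimodD.
Qed.

Lemma bimod_add_bimod V W : is_bimod V -> is_bimod W -> is_bimod (bimod_add V W).
Proof.
move=> [V0 VB VM] [W0 WB WM]; split.
- by exists 0; rewrite ?subr0.
- move=> x y [v Vv Wv] [w Vw Ww]; exists (v - w); first exact: VB.
  by rewrite opprD addrACA -opprD; apply: WB.
- move=> b x Bb [v Vv Wv]; split.
    by exists (b * v); [case: (VM b v Bb Vv) | rewrite -mulrBr; case: (WM _ _ Bb Wv)].
  by exists (v * b); [case: (VM b v Bb Vv) | rewrite -mulrBl; case: (WM _ _ Bb Wv)].
Qed.

(** Greedy construction: [M j] is added to [C] unless [I + C] already contains it. Otherwise it
    meets [I + C] only in 0, so [I] and the enlarged [C] still meet trivially. The second hypothesis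
    says that each [M j] is simple or zero. *)
Lemma bimod_complement (T : eqType) (M : T -> set S) (I : set S) (s : seq T) :
    (forall j, is_bimod (M j)) ->
    (forall j W, is_bimod W -> M j `<=` W \/ M j `&` W `<=` [set 0]) ->
    is_bimod I ->
  exists C, [/\ is_bimod C, I `&` C `<=` [set 0]
    & forall j, j \in s -> M j `<=` bimod_add I C].
Proof.
move=> bM sM bI; elim: s => [|j s [C [bC IC sC]]].
  exists [set 0]; split=> //.
  split=> // [x y -> ->|b x _ ->]; first by rewrite /= subr0.
  by rewrite /= mulr0 mul0r.
have [MW|MW] := sM j _ (bimod_add_bimod bI bC).
  exists C; split=> // k; rewrite inE => /orP[/eqP ->//|]; exact: sC.
have [C0 CB _] := bC; have [I0 IB _] := bI; have [M0 MB _] := bM j.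
exists (bimod_add C (M j)); split; first exact: bimod_add_bimod.
(* For [x] in [I] and in [C + M j], the difference [x - c] lies in both [M j] and [I + C], so
   [x = c] is in [I] and [C]. *)
- move=> x [Ix [c Cc Mxc]]; have : x - c = 0.
    apply: MW; split=> //; exists x => //.
    by rewrite addrAC subrr sub0r -sub0r; apply: CB.
  by move/eqP; rewrite subr_eq0 => /eqP xc; apply: IC; split=> //; rewrite xc.
- move=> k; rewrite inE => /orP[/eqP ->|ks] x Mx; last first.
    have [v Iv Cv] := sC k ks x Mx.
    by exists v => //; exists (x - v) => //; rewrite subrr.
  by exists 0 => //; exists 0 => //; rewrite !subr0.
Qed.

(** [f x] is the component of [x] in [I] along a complement [C]. The component is unique, which
    gives additivity and linearity. *)
Lemma bimod_projection (T : finType) (M : T -> set S) (I : set S) :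
    (forall j, is_bimod (M j)) ->
    (forall j W, is_bimod W -> M j `<=` W \/ M j `&` W `<=` [set 0]) ->
    (forall x, exists2 m : T -> S, forall j, M j (m j) & x = \sum_j m j) ->
    is_bimod I ->
  exists f : S -> S, [/\ forall x, I (f x), forall x, I x -> f x = x,
    {morph f : x y / x + y} & forall b x, B b -> f (b * x) = b * f x].
Proof.
move=> bM sM spanM bI.
have [C [bC IC sC]] := bimod_complement (enum T) bM sM bI.
have tot x : exists v, I v /\ C (x - v).
  suff : bimod_add I C x by case=> v; exists v.
  have [m Mm ->] := spanM x; apply: bimod_sum => [|j]; first exact: bimod_add_bimod.
  by apply: (sC j) => //; rewrite mem_enum.
have [f fP] := choice tot.
have fE x v : I v -> C (x - v) -> f x = v.
  move=> Iv Cv; have [If Cf] := fP x.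
  have [C0 CB _] := bC; have [I0 IB _] := bI.
  apply/eqP; rewrite -subr_eq0; apply/eqP; apply: IC; split; first exact: IB.
  have -> : f x - v = (x - v) - (x - f x).
    by rewrite opprB [RHS]addrC addrA subrK.
  exact: CB.
have [C0 CB CM] := bC; have [I0 IB IM] := bI.
exists f; split=> [x|x Ix|x y|b x Bb].
- by case: (fP x).
- by apply: fE => //; rewrite subrr.
- have [Ix Cx] := fP x; have [Iy Cy] := fP y.
  apply: fE; first exact: bimodD.
  by rewrite opprD addrACA; apply: bimodD.
- have [Ix Cx] := fP x.
  by apply: fE; [case: (IM _ _ Bb Ix) | rewrite -mulrBr; case: (CM _ _ Bb Cx)].
Qed.

End Bimodules.

(** * Rings whose ideals have right identities *)

Section CentralIdempotents.
Variable S : pzRingType.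
Implicit Types (I K : set S) (e f : S).

Definition central_idem e : Prop := e * e = e /\ forall x, e * x = x * e.

(** For a central idempotent this is the ideal [eS]; as a set of fixed points, membership is an
    equation. *)
Definition principal e : set S := [set x | e * x = x].

(** Zero is an atom, since [is_simple] accepts the zero ring. *)
Definition atom e : Prop := central_idem e /\ is_simple (principal e).

Lemma principal_ideal e : central_idem e -> is_ideal setT (principal e).
Proof.
move=> [ee ce]; split=> //= [|x y ex ey|a x _ ex]; first exact: mulr0.
  by rewrite /principal /= mulrBr ex ey.
by rewrite /principal /= mulrA ce -mulrA ex mulrA ex.
Qed.

Lemma principal_self e : central_idem e -> principal e e.
Proof. by case. Qed.

(** Outside factors are absorbed by [e]: [a x = (a e) x] with [a e] in [eS], and likewise on the
    right. *)
Lemma ideal_in_principal e I :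
  central_idem e -> is_ideal (principal e) I -> is_ideal setT I.
Proof.
move=> ce [Ie I0 IB IM]; split=> // a x _ Ix.
have ex : e * x = x by apply: Ie.
have [_ _ _ eM] := principal_ideal ce.
have [ea ae] := eM a e Logic.I (principal_self ce).
have xe : x * e = x by rewrite -ce.2.
split.
  by rewrite -ex mulrA; apply: (IM _ _ ea Ix).1.
by rewrite -xe -mulrA; apply: (IM _ _ ae Ix).2.
Qed.

Hypothesis right_unit : forall I, is_ideal setT I ->
  exists2 e, I e & forall x, I x -> x * e = x.

Lemma ideal_principal I : is_ideal setT I ->
  exists2 e, central_idem e & I = principal e.
Proof.
move=> idI; have [_ I0 IB IM] := idI; have [e Ie Ire] := right_unit idI.
(* (1 - e) I is a two-sided ideal of square zero, so its right unit is 0. *)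
pose N : set S := [set x | I x /\ e * x = 0].
have ese s : e * s * e = e * s by apply/Ire/(IM s e _ _).2.
have idN : is_ideal setT N.
  split=> //= [|x y [Ix ex] [Iy ey]|a x _ [Ix ex]].
  - by split; rewrite ?mulr0.
  - by split; [exact: IB | rewrite mulrBr ex ey subrr].
  - split; split; [exact: (IM a x _ _).1| |exact: (IM a x _ _).2|].
      by rewrite mulrA -ese -mulrA ex mulr0.
    by rewrite mulrA ex mul0r.
have [n [In en] Nrn] := right_unit idN.
have N0 x : N x -> x = 0.
  move=> Nx; have [Ix _] := Nx.
  by rewrite -(Nrn x Nx) -(Ire _ Ix) -mulrA en mulr0.
have Ile x : I x -> e * x = x.
  move=> Ix; apply/eqP; rewrite eq_sym -subr_eq0; apply/eqP/N0; split.
    by apply: IB => //; apply: (IM e x _ _).1.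
  by rewrite mulrBr mulrA (Ire e) // subrr.
exists e.
  split=> [|x]; first exact: Ire.
  (* As [e] is now also a left identity of [I], [e x e] equals both [x e] and [e x]. *)
  rewrite -(Ile (x * e)) ?mulrA ?ese //; exact: (IM x e _ _).1.
apply/seteqP; split=> x; first exact: Ile.
by move=> <-; apply: (IM x e _ _).2.
Qed.

(** For central idempotents, the complement of their join; it is 0 exactly when they generate the
    whole ring. *)
Definition coprod (s : seq S) : S := \prod_(f <- s) (1 - f).

Lemma coprod_cat s r : coprod (s ++ r) = coprod s * coprod r.
Proof. exact: big_cat. Qed.

Lemma central_idemC e : central_idem e -> central_idem (1 - e).
Proof.
move=> [ee ce]; split=> [|x]; last by rewrite mulrBl mulrBr mul1r mulr1 ce.
by rewrite mulrBr mulrBl mulr1 mul1r mulrBl ee mul1r subrr subr0.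
Qed.

Lemma central_idemM e f : central_idem e -> central_idem f -> central_idem (e * f).
Proof.
move=> [ee ce] [ff cf]; split=> [|x]; last by rewrite -mulrA cf mulrA ce mulrA.
by rewrite mulrA -[e * f * e]mulrA cf mulrA ee -mulrA ff.
Qed.

Lemma central_idem_coprod (s : seq S) :
  (forall f, f \in s -> central_idem f) -> central_idem (coprod s).
Proof.
rewrite /coprod; elim: s => [|f s IH] sc.
  by rewrite big_nil; split=> [|x]; rewrite ?mulr1 ?mul1r.
rewrite big_cons; apply: central_idemM.
  by apply/central_idemC/sc; rewrite mem_head.
by apply: IH => g gs; apply: sc; rewrite inE gs orbT.
Qed.

Lemma coprod_mem s f : (forall g, g \in s -> central_idem g) -> f \in s ->
  f * coprod s = 0.
Proof.
rewrite /coprod; elim: s => // g s IH sc; rewrite inE big_cons mulrA.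
have [_ cg] := central_idemC (sc g (mem_head g s)).
case/orP=> [/eqP ->|fs]; last first.
  rewrite -cg -mulrA IH ?mulr0 // => h hs; by apply: sc; rewrite inE hs orbT.
by rewrite mulrBr mulr1 (sc g (mem_head g s)).1 subrr mul0r.
Qed.

(** A repeated factor [1 - f] changes nothing, because [f] kills the rest of the product. This lets
    a list of atoms be made duplicate-free before its sum is taken. *)
Lemma coprod_undup s : (forall g, g \in s -> central_idem g) ->
  coprod (undup s) = coprod s.
Proof.
elim: s => //= f s IH sc.
have sc' g : g \in s -> central_idem g by move=> gs; apply: sc; rewrite inE gs orbT.
rewrite [RHS]/coprod big_cons -/(coprod s) mulrBl mul1r.
case: ifP => fs; first by rewrite coprod_mem // subr0 IH.
by rewrite /coprod big_cons -!/(coprod _) mulrBl mul1r IH.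
Qed.

(** [ef] generates an ideal of both [eS] and [fS]. If it is nonzero, simplicity forces [ef = e] and
    [ef = f]. *)
Lemma atom_orthogonal e f : atom e -> atom f -> e <> f -> e * f = 0.
Proof.
move=> [ce se] [cf sf] ef.
have cef : central_idem (e * f) by apply: central_idemM.
have h (g : S) : central_idem g -> is_simple (principal g) -> g * (e * f) = e * f ->
    e * f = 0 \/ e * f = g.
  move=> cg sg gef; have idg : is_ideal (principal g) (principal (e * f)).
    have [_ P0 PB PM] := principal_ideal cef.
    split=> // [x xP|a x _]; last exact: PM.
    by rewrite /principal /= -xP mulrA gef.
  have [E|E] := sg _ idg.
    by left; have := principal_self cef; rewrite E.
  right; have : principal (e * f) g by rewrite E; apply: principal_self.
  by rewrite /principal /= -cg.2 gef.
have [|//|e1] := h e ce se; first by rewrite mulrA ce.1.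
have [|//|e2] := h f cf sf; first by rewrite cf.2 -mulrA cf.1.
by case: ef; rewrite -e1 e2.
Qed.

Lemma coprod_orthogonal (s : seq S) : uniq s -> (forall f, f \in s -> atom f) ->
  coprod s = 1 - \sum_(f <- s) f.
Proof.
rewrite /coprod; elim: s => [|f s IH] /=; first by rewrite !big_nil subr0.
case/andP=> fs us sA; rewrite !big_cons IH //; last first.
  by move=> g gs; apply: sA; rewrite inE gs orbT.
rewrite mulrBl mul1r mulrBr mulr1 mulr_sumr [X in f - X]big1_seq ?subr0.
  by rewrite opprD addrA addrAC.
move=> g /= gs; apply: atom_orthogonal.
- by apply: sA; rewrite mem_head.
- by apply: sA; rewrite inE gs orbT.
- by move=> fg; rewrite fg gs in fs.
Qed.

Lemma ideal_add I K : is_ideal setT I -> is_ideal setT K ->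
  is_ideal setT (bimod_add I K).
Proof.
move=> [_ I0 IB IM] [_ K0 KB KM].
by have [] := @bimod_add_bimod S setT I K (And3 I0 IB IM) (And3 K0 KB KM).
Qed.

(** Zorn's lemma: the union of a nonempty chain of ideals missing [e] is again such an ideal. *)
Lemma maximal_ideal_avoiding e : e <> 0 ->
  exists M, [/\ is_ideal setT M, ~ M e
    & forall K, is_ideal setT K -> M `<=` K -> ~ K e -> K = M].
Proof.
move=> e0.
(* [set0] is admitted because [Zorn_bigcup] includes the empty chain. *)
pose P (A : set S) := (A = set0 \/ is_ideal setT A) /\ ~ A e.
have [F FP tF|M [[idM Me] maxM]] := @Zorn_bigcup S P.
  split; last by case=> A /FP[_]; apply.
  have [[A0 FA0 [x0 A0x0]]|none] :=
      pselect (exists2 A, F A & exists x, A x); last first.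
    by left; apply/seteqP; split=> // x [A FA Ax]; case: none; exists A => //; exists x.
  have idF A x : F A -> A x -> is_ideal setT A.
    by move=> /FP[[->|//] _].
  right; split=> //.
  - by exists A0 => //; case: (idF _ _ FA0 A0x0).
  - move=> x y [A FA Ax] [C FC Cy].
    have [_ _ AB _] := idF _ _ FA Ax; have [_ _ CB _] := idF _ _ FC Cy.
    by have [sAC|sCA] := tF A C FA FC;
      [exists C => //; apply: CB => //; apply: sAC
      |exists A => //; apply: AB => //; apply: sCA].
  - move=> a x _ [A FA Ax]; have [_ _ _ AM] := idF _ _ FA Ax.
    by have [] := AM a x Logic.I Ax; split; exists A.
have id0 : is_ideal setT [set (0 : S)].
  split=> // [x y -> ->|a x _ ->]; first by rewrite /= subr0.
  by rewrite /= mulr0 mul0r.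
case: idM => [M0|idM]; last first.
  exists M; split=> // K idK MK Ke; apply: contrapT => KM.
  apply: (maxM K _ (conj (or_intror idK) Ke)).
  by split=> // KsM; apply: KM; apply/seteqP.
(* The empty set is not maximal, since the zero ideal also misses [e]. *)
have e0' : ~ [set 0] e by [].
exfalso; apply: (maxM [set 0] _ (conj (or_intror id0) e0')).
by rewrite M0; split=> // /(_ 0 erefl).
Qed.

(** Let [mS] be maximal among the ideals missing [q], and [f = q(1 - m)]. For an ideal [K] of [fS],
    either [mS + K] contains [q], and multiplying by [f] puts [f] in [K]; or [K] lies in [mS], and
    [fm = 0] gives [K = 0]. *)
Lemma atom_below q : central_idem q -> q <> 0 ->
  exists f, [/\ atom f, f * q = f & f <> 0].
Proof.
move=> cq q0; have [M [idM Mq maxM]] := maximal_ideal_avoiding q0.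
have [m cm EM] := ideal_principal idM; rewrite {}EM in idM Mq maxM.
have cm' := central_idemC cm.
have cf := central_idemM cq cm'; set f := q * (1 - m) in cf.
have fq : f * q = f by rewrite /f -mulrA cm'.2 mulrA cq.1.
have fm : f * m = 0 by rewrite /f -mulrA mulrBl mul1r cm.1 subrr mulr0.
exists f; split=> //; last first.
  move=> f0; apply: Mq; rewrite /principal /=; apply/eqP; rewrite eq_sym -subr_eq0.
  by rewrite cm.2 -{1}[q]mulr1 -mulrBr -/f f0.
split=> // K idK; have idK' := ideal_in_principal cf idK.
have [Kf K0 _ KM] := idK.
have [Kq|nKq] := pselect (bimod_add (principal m) K q).
  right; apply/seteqP; split=> // x fx.
  have Kff : K f.
    have [v mv Kv] := Kq.
    have -> : f = f * (q - v) by rewrite mulrBr fq -mv mulrA fm mul0r subr0.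
    by apply: (KM f _ _ Kv).1; apply: principal_self.
  by rewrite -fx; apply: (KM x f _ _).2.
left; apply/seteqP; split=> x; last by move=> ->.
move=> Kx; have : principal m x.
  rewrite -(maxM _ (ideal_add idM idK') _ nKq).
    by exists 0; rewrite ?subr0 //; case: idM.
  by move=> y my; exists y; rewrite ?subrr.
by move=> mx; rewrite /= -(Kf x Kx) -mx mulrA fm mul0r.
Qed.

(** [J] is the ideal generated by all atoms. It equals [eS], and finiteness comes from [e] being
    killed by the [coprod] of one finite list [s]. A nonzero atom [f] below [coprod s] would lie in
    [J], whence [f = e f coprod s = 0]. *)
Lemma unit_sum_atoms :
  exists s : seq S, [/\ uniq s, forall f, f \in s -> atom f & 1 = \sum_(f <- s) f].
Proof.
pose J : set S := [set x | exists2 s : seq S,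
   forall f, f \in s -> atom f & x * coprod s = 0].
have cJ s : (forall f, f \in s -> atom f) -> central_idem (coprod s).
  by move=> sA; apply: central_idem_coprod => f /sA[].
have idJ : is_ideal setT J.
  split=> //; first by exists [::]; rewrite ?mul0r.
  - move=> x y [s sA xs] [r rA yr]; exists (s ++ r).
      by move=> f; rewrite mem_cat => /orP[/sA|/rA].
    rewrite coprod_cat mulrBl mulrA xs mul0r.
    by rewrite (cJ s sA).2 mulrA yr mul0r subrr.
  - move=> a x _ [s sA xs]; split; exists s => //; first by rewrite -mulrA xs mulr0.
    by rewrite -mulrA -(cJ s sA).2 mulrA xs mul0r.
have [e ce EJ] := ideal_principal idJ.
have : J e by rewrite EJ; apply: principal_self.
case=> s sA es; have cq := cJ s sA.
have q0 : coprod s = 0.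
  apply: contrapT => /(atom_below cq)[f [fA fq f0]]; apply: f0.
  have : J f.
    exists [:: f]; first by move=> g; rewrite inE => /eqP ->.
    by rewrite /coprod big_seq1 mulrBr mulr1 fA.1.1 subrr.
  rewrite EJ /principal /= => ef.
  by rewrite -fq -ef ce.2 -mulrA es mulr0.
exists (undup s).
have sA' f : f \in undup s -> atom f by rewrite mem_undup; apply: sA.
split=> //; first exact: undup_uniq.
have q0' : coprod (undup s) = 0 by rewrite coprod_undup // => f /sA[].
by apply/eqP; rewrite -subr_eq0 -coprod_orthogonal ?undup_uniq ?q0'.
Qed.

Lemma semisimple_right_unit : is_semisimple S.
Proof.
have [s [us sA s1]] := unit_sum_atoms.
have sA' (i : 'I_(size s)) : atom s`_i by apply/sA/mem_nth.
have s1' : \sum_(i < size s) s`_i = 1 by rewrite s1 (big_nth 0) big_mkord.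
exists (size s), (fun i => principal s`_i); split=> [i|i|].
- by apply: principal_ideal; case: (sA' i).
- by case: (sA' i).
split=> [x|y z yP zP yz i _].
  exists (fun i : 'I_(size s) => s`_i * x) => [i _|];
    last by rewrite -mulr_suml s1' mul1r.
  by rewrite /principal /= mulrA (sA' i).1.1.
(* By orthogonality, multiplication by one atom recovers the corresponding component; this gives
   uniqueness. *)
have extract (w : 'I_(size s) -> S) :
    (forall i : 'I_(size s), true -> principal s`_i (w i)) ->
    s`_i * (\sum_j w j) = w i.
  move=> wP; rewrite mulr_sumr (bigD1 i) //= wP // big1 ?addr0 // => j ji.
  rewrite -(wP j) // mulrA [s`_i * _]atom_orthogonal ?mul0r //.
  by apply/eqP; rewrite nth_uniq // eq_sym.
by rewrite -(extract y) // -(extract z) // yz.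
Qed.

End CentralIdempotents.

(** * Cancellation and inverses in a groupoid *)

Section Groupoid.
Variable G : finGroupoid.
Implicit Types g h k : G.

Lemma gcompKg g h : gdom g = gcod h -> gcomp (ginv g) (gcomp g h) = h.
Proof. by move=> gh; rewrite gcompA ?gdom_ginv // gcompVg gh gcomp_gcod. Qed.

Lemma gcompVKg g h : gcod g = gcod h -> gcomp g (gcomp (ginv g) h) = h.
Proof. by move=> gh; rewrite -{1}(ginvK g) gcompKg // gdom_ginv. Qed.

(** Since [g g^-1 = (gh)(h^-1 g^-1)], composing with [(gh)^-1] on the left and cancelling gives the
    formula. *)
Lemma ginv_gcomp g h : gdom g = gcod h ->
  ginv (gcomp g h) = gcomp (ginv h) (ginv g).
Proof.
move=> gh; have c : gcod g = gcod (gcomp g h) by rewrite gcod_gcomp.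
have hg : gdom (ginv h) = gcod (ginv g) by rewrite gdom_ginv gcod_ginv.
rewrite -[LHS]gcomp_gdom gdom_ginv -c -(gcompgV g).
have {1}-> : ginv g = gcomp h (gcomp (ginv h) (ginv g)).
  by rewrite gcompVKg // gcod_ginv.
have c' : gcod (gcomp (ginv h) (ginv g)) = gdom h by rewrite gcod_gcomp // gcod_ginv.
by rewrite (@gcompA _ g h) ?c' // gcompKg // c' gdom_gcomp.
Qed.

End Groupoid.

(** * The identities [1_g] under the partial action *)

Section Averaging.
Variables (G : finGroupoid) (R : pzRingType) (alpha : unitalPartialAction G R).
Local Notation D := (pideal alpha).
Local Notation act := (pact alpha).
Local Notation one_ := (pone alpha).
Local Notation S := (skewRing alpha).
Implicit Types (g h k m : G) (r a b : R) (x y s : S).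

Lemma pone_idem g : one_ g * one_ g = one_ g.
Proof. exact/mul1p/ponein. Qed.

Lemma pact_pone g : act g (one_ (ginv g)) = one_ g.
Proof.
have Dy := pact_in (ponein alpha (ginv g)).
have Dz := pactV_in (ponein alpha g).
rewrite -[LHS](mulp1 Dy) -{1}(pactVK (ponein alpha g)) -pactM //; last exact: ponein.
by rewrite mul1p // pactVK //; apply: ponein.
Qed.

Lemma pact_poneV g : act (ginv g) (one_ g) = one_ (ginv g).
Proof. by rewrite -{2}(ginvK g) pact_pone. Qed.

(** Otherwise [r] would have two decompositions in the direct sum, one supported at [e] and one at
    [f]. *)
Lemma pideal_disjoint e f r : ob e -> ob f -> e != f -> D e r -> D f r -> r = 0.
Proof.
move=> obe obf ef re rf; have [_ uniq] := pideal_sum alpha.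
have := uniq (fun i => if i == e then r else 0) (fun i => if i == f then r else 0).
move=> /(_ _ _ _ e obe); rewrite eqxx (negPf ef); apply.
- by move=> i _; case: eqP => [->|_] //; apply: pideal0.
- by move=> i _; case: eqP => [->|_] //; apply: pideal0.
- rewrite (bigD1 e) //= eqxx big1 ?addr0 => [|i /andP[_ /negPf ->] //].
  by rewrite (bigD1 f) //= eqxx big1 ?addr0 => [//|i /andP[_ /negPf ->]].
Qed.

Lemma ob_gcod g : ob (gcod g).
Proof. by rewrite /ob gdom_gcod. Qed.

Lemma ginv_ob g : ob g -> ginv g = g.
Proof.
move=> /eqP obg; rewrite -(gcomp_gdom (ginv g)) gdom_ginv -{2}obg gcod_gdom obg.
by rewrite gcompVg obg.
Qed.

(** Both sides are the identity of the intersection of [R_k] and [R_kg]: the product [z y] is shown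
    to equal [y] and [z]. *)
Lemma smul_pone k g : gdom k = gcod g ->
  act k (one_ (ginv k) * one_ g) = one_ k * one_ (gcomp k g).
Proof.
move=> kg; set y := act k _; set z := one_ k * _.
have Dk : D k y by apply/pact_in/pidealMr/ponein.
have Dkg : D (gcomp k g) y.
  rewrite /y -(pact_poneV k); exact: smul_in kg (ponein _ _) (ponein _ _).
have zy : z * y = y by rewrite /z -mulrA !mul1p.
have Dkz : D k z by apply/pidealMr/ponein.
pose x := act (ginv k) z.
have Dkx : D (ginv k) x by apply: pactV_in.
have Dgx : D g x.
  (* Writing [g = k^-1 (kg)] lets [smul_in] for [k^-1] place [x] in [R_g]. *)
  rewrite -(gcompKg kg) /x /z.
  have := @smul_in _ _ alpha (ginv k) (gcomp k g) (one_ (ginv k)) (one_ (gcomp k g)).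
  rewrite /smul ginvK pact_pone; apply; try exact: ponein.
  by rewrite gdom_ginv gcod_gcomp.
rewrite -zy -[LHS]/(z * y) -{1}(pactVK Dkz) -/x /y -pactM //; last exact/pidealMr/ponein.
by rewrite mulrA !mulp1 // pactVK.
Qed.

(** * The embedding of [R], the elements [u_g], and averaging *)

Fact iota_in r : [ffun g => if ob g then r * one_ g else 0] \in skew_pred alpha.
Proof.
by apply/asboolP=> g; rewrite ffunE; case: ifP => _;
  [apply/pidealMl/ponein | exact: pideal0].
Qed.

Definition iota r : S := SkewRing (iota_in r).

Fact unit_delta_in g : delta g (one_ g) \in skew_pred alpha.
Proof.
by apply/asboolP=> k; rewrite ffunE; case: eqP => [->|_];
  [exact: ponein | exact: pideal0].
Qed.

Definition unit_delta g : S := SkewRing (unit_delta_in g).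

Lemma iotaE r g : iota r g = if ob g then r * one_ g else 0.
Proof. by rewrite /= ffunE. Qed.

Lemma unit_deltaE g k : unit_delta g k = if k == g then one_ g else 0.
Proof. by rewrite /= ffunE. Qed.

Lemma skew_sumE (I : finType) (P : pred I) (F : I -> S) g :
  (\sum_(i | P i) F i) g = \sum_(i | P i) F i g.
Proof.
apply: (big_morph (fun s : S => s g)); first by move=> x y; apply: skew_addE.
by rewrite /= ffunE.
Qed.

(** Only the object [c(k)] contributes to the coefficient at [k], and its identity fixes [s k]. *)
Lemma iota_mulE r s k : (iota r * s) k = r * s k.
Proof.
rewrite [LHS]skew_mulE (bigD1 (gcod k)) //= [X in _ + X]big1 => [|e ek].
  rewrite addr0 (bigD1 k) /=; last by rewrite gdom_gcod gcomp_gcod !eqxx.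
  rewrite big1 ?addr0 => [|h /andP[/andP[/eqP ch /eqP <-]]]; last first.
    by rewrite -gdom_gcod ch gcomp_gcod eqxx.
  have obk := ob_gcod k; have Dk := pidealMl r (ponein alpha (gcod k)).
  rewrite ffunE obk /smul (ginv_ob obk) (pact_ob obk Dk).
  rewrite pact_ob //; last exact/pidealMr.
  by rewrite -mulrA mul1p //; apply/pideal_cod/skewP.
rewrite big1 // => h /andP[/eqP ch /eqP ehk].
rewrite ffunE; case: ifP => [/eqP obe|_]; last by rewrite smul0l.
by move: ek; rewrite -ehk gcod_gcomp // -obe gcod_gdom eqxx.
Qed.

Lemma iotaD a b : iota (a + b) = iota a + iota b.
Proof.
apply: skew_eq => g; rewrite skew_addE !iotaE.
by case: ifP => _; rewrite ?addr0 // mulrDl.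
Qed.

Lemma iotaM a b : iota (a * b) = iota a * iota b.
Proof.
apply: skew_eq => g; rewrite iota_mulE !iotaE.
by case: ifP => _; rewrite ?mulr0 // mulrA.
Qed.

Lemma iota1 : iota 1 = 1.
Proof.
by apply: skew_eq => g; rewrite iotaE [RHS]ffunE mul1r.
Qed.

Lemma iota0 : iota 0 = 0.
Proof. by apply: (addrI (iota 0)); rewrite -iotaD !addr0. Qed.

Lemma iotaN a : iota (- a) = - iota a.
Proof. by apply: (addrI (iota a)); rewrite -iotaD !subrr iota0. Qed.

Lemma iota_delta g r k : (iota r * unit_delta g) k = if k == g then r * one_ g else 0.
Proof. by rewrite iota_mulE unit_deltaE; case: ifP; rewrite ?mulr0. Qed.

Lemma skew_decomp s : s = \sum_g iota (s g) * unit_delta g.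
Proof.
apply: skew_eq => k; rewrite skew_sumE (bigD1 k) //= big1 => [|g gk].
  by rewrite addr0 [RHS]iota_delta eqxx mulp1 //; apply: skewP.
by rewrite [LHS]iota_delta eq_sym (negPf gk).
Qed.

Lemma iota_pone g : iota (one_ g) * unit_delta g = unit_delta g.
Proof.
by apply: skew_eq => k; rewrite iota_delta unit_deltaE pone_idem.
Qed.

(** This is how [u_g] normalises [R]: of the terms of [iota r], only the one at the object [d(g)]
    can be composed with [g]. *)
Lemma delta_iota g r :
  unit_delta g * iota r = iota (act g (r * one_ (ginv g))) * unit_delta g.
Proof.
apply: skew_eq => k; rewrite iota_delta [LHS]skew_mulE (bigD1 g) //=.
rewrite [X in _ + X]big1 ?addr0 => [|h hg]; last first.
  by apply: big1 => m _; rewrite unit_deltaE (negPf hg) smul0l.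
have gE h : gdom g = gcod h -> ob h -> h = gdom g.
  by move=> gh /eqP obh; rewrite gh -obh gcod_gdom.
case: eqP => [->|kg]; last first.
  rewrite big1 // => h /andP[/eqP gh /eqP ghk]; rewrite iotaE.
  case: ifP => [obh|_]; last by rewrite smul0r.
  by case: kg; rewrite -ghk (gE h) // gcomp_gdom.
rewrite (bigD1 (gdom g)) /=; last by rewrite gcod_gdom gcomp_gdom !eqxx.
rewrite big1 ?addr0 => [|h /andP[/andP[/eqP gh _] hg]]; last first.
  rewrite iotaE; case: ifP => [obh|_]; last by rewrite smul0r.
  by case/eqP: hg; apply: gE.
rewrite unit_deltaE iotaE eqxx /ob gdom_gdom eqxx /smul pact_poneV.
have DV : D (ginv g) (r * one_ (ginv g)) by apply/pidealMl/ponein.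
rewrite (mulp1 (pact_in DV)) mulrA -pone_central -mulrA.
congr (act g (r * _)); apply: mulp1.
by rewrite -gcod_ginv; apply/pideal_cod/ponein.
Qed.

Lemma delta_mul k g :
  unit_delta k * unit_delta g =
  if gdom k == gcod g then iota (one_ k) * unit_delta (gcomp k g) else 0.
Proof.
apply: val_inj;
  rewrite [LHS](@skew_mul_delta _ _ _ (unit_delta k) (unit_delta g) _ _ _ _ erefl erefl).
case: eqP => // kg; apply/ffunP => m; rewrite [RHS]iota_delta ffunE.
by rewrite pact_poneV smul_pone.
Qed.

Lemma delta_iota_pone g : unit_delta g * iota (one_ (ginv g)) = unit_delta g.
Proof. by rewrite delta_iota pone_idem pact_pone iota_pone. Qed.

(** The sum of [u_g (x) u_{g^-1}] over [R] commutes with [s]; [f] is applied to the second factor.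
    By additivity it suffices to take [s = r u_k]. *)
Lemma average_comm (f : S -> S) s :
    {morph f : x y / x + y} -> (forall r x, f (iota r * x) = iota r * f x) ->
  s * (\sum_g unit_delta g * f (unit_delta (ginv g))) =
  \sum_g unit_delta g * f (unit_delta (ginv g) * s).
Proof.
move=> fD fZ.
have f0 : f 0 = 0 by apply: (addrI (f 0)); rewrite -fD !addr0.
pose F s := \sum_g unit_delta g * f (unit_delta (ginv g) * s).
have FD : {morph F : x y / x + y}.
  by move=> x y; rewrite /F -big_split; apply: eq_bigr => g _; rewrite mulrDr fD mulrDr.
have F0 : F 0 = 0 by apply: big1 => g _; rewrite mulr0 f0 mulr0.
rewrite -/(F s) (skew_decomp s) (big_morph F FD F0) mulr_suml.
apply: eq_bigr => k _; set r := s k; have Dr : D k r := skewP s k.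
rewrite /F mulr_sumr.
rewrite (bigID (fun g => gdom k == gcod g)) /= [X in _ + X]big1 ?addr0; last first.
  by move=> g /negPf kg; rewrite -mulrA [unit_delta k * _]mulrA delta_mul kg mul0r mulr0.
rewrite [RHS](bigID (fun m => gcod m == gcod k)) /= [X in _ = _ + X]big1 ?addr0;
  last first.
  move=> m /negPf mk; rewrite mulrA delta_iota -mulrA delta_mul gdom_ginv mk.
  by rewrite mulr0 f0 mulr0.
(* The terms left are those with [d(k) = c(g)] and those with [c(m) = c(k)]; [m = kg] matches
   them. *)
rewrite [RHS](reindex_onto (gcomp k) (gcomp (ginv k))) /=; last first.
  by move=> m /eqP mk; rewrite gcompVKg.
apply: eq_big => [g|g /eqP kg].
  case: eqP => [kg|kg].
    by rewrite gcod_gcomp // eqxx gcompKg ?eqxx.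
  apply/esym/andP => -[/eqP c /eqP h]; apply: kg.
  by rewrite -h gcod_gcomp ?gcod_ginv // gdom_ginv.
rewrite -mulrA [unit_delta k * _]mulrA delta_mul kg eqxx.
rewrite [iota r * _]mulrA [iota r * _]mulrA -iotaM (mulp1 Dr).
set m := gcomp k g.
(* On the right, [r] moves left past [u_{m^-1}], out of [f] by linearity, and back past [u_m], where
   the two actions cancel. What remains is [m^-1 k = g^-1]. *)
rewrite [unit_delta (ginv m) * _]mulrA delta_iota ginvK -[iota (act _ _) * _ * _]mulrA.
rewrite fZ [RHS]mulrA delta_iota.
rewrite mulp1; last exact/pactV_in/pidealMl/ponein.
rewrite pactVK; last exact/pidealMl/ponein.
rewrite iotaM -[iota r * iota _ * _]mulrA iota_pone -[LHS]mulrA -[RHS]mulrA.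
rewrite delta_mul gdom_ginv gcod_gcomp // eqxx fZ.
rewrite [unit_delta m * (iota _ * _)]mulrA delta_iota_pone.
congr (_ * (_ * f (unit_delta _))).
by rewrite /m ginv_gcomp // -gcompA ?gdom_ginv ?gcod_ginv // gcompVg kg
  -gdom_ginv gcomp_gdom.
Qed.

(** [u_g u_{g^-1}] is [1_g] placed at the object [c(g)], and the trace of 1 is the sum of all [1_g].
    Multiplying by the identity of an object [k] keeps the [1_g] with [c(g) = k]. *)
Lemma sum_delta_deltaV :
  \sum_g unit_delta g * unit_delta (ginv g) = iota (trace alpha 1).
Proof.
apply: skew_eq => k; rewrite skew_sumE iotaE /trace mulr_suml.
transitivity (\sum_g if gcod g == k then one_ g else 0); last first.
  case: ifP => [obk|nobk]; last first.
    by apply: big1 => g _; case: eqP => // gk; rewrite -gk ob_gcod in nobk.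
  apply: eq_bigr => g _; rewrite mul1r pact_pone; case: eqP => [<-|/eqP gk].
    by rewrite mulp1 //; apply/pideal_cod/ponein.
  apply/esym/(pideal_disjoint (ob_gcod g) obk gk); last exact/pidealMl/ponein.
  exact/pidealMr/pideal_cod/ponein.
apply: eq_bigr => g _; rewrite delta_mul gcod_ginv eqxx iota_delta gcompgV eq_sym.
by case: eqP => // _; rewrite mulp1 //; apply/pideal_cod/ponein.
Qed.

Lemma iota_trace_central s : iota (trace alpha 1) * s = s * iota (trace alpha 1).
Proof.
rewrite -sum_delta_deltaV (average_comm (f := id)) // mulr_suml.
by apply: eq_bigr => g _; rewrite mulrA.
Qed.

(** * Simple bimodules in the skew ring and right identities of its ideals *)

Section SemisimpleBase.
Variables (n : nat) (A : 'I_n -> set R).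
Hypothesis A_ideal : forall i, is_ideal setT (A i).
Hypothesis A_simple : forall i, is_simple (A i).
Hypothesis A_sum : is_direct_sum xpredT A.

Definition slice (j : G * 'I_n) : set S :=
  [set iota a * unit_delta j.1 | a in A j.2].

(** Moving [r] left past [u_g] turns right multiplication by [r] into right multiplication inside
    [A i]. *)
Lemma slice_bimod j : is_bimod (range iota) (slice j).
Proof.
case: j => g i; have [_ A0 AB AM] := A_ideal i; split=> /=.
- by exists 0; rewrite ?iota0 ?mul0r.
- move=> _ _ [a Aa <-] [b Ab <-]; exists (a - b); first exact: AB.
  by rewrite iotaD iotaN mulrBl.
- move=> _ _ [r _ <-] [a Aa <-]; split.
    by exists (r * a); [case: (AM r a) | rewrite iotaM mulrA].
  exists (a * act g (r * one_ (ginv g)));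
    first by case: (AM (act g (r * one_ (ginv g))) a).
  by rewrite -mulrA delta_iota mulrA -iotaM.
Qed.

(** The coefficients [a] in [A i] with [a u_g] in [W] form an ideal of [A i], so they are only 0 or
    all of [A i]. *)
Lemma slice_simple j W : is_bimod (range iota) W ->
  slice j `<=` W \/ slice j `&` W `<=` [set 0].
Proof.
case: j => g i [W0 WB WM]; have [_ A0 AB AM] := A_ideal i.
pose K : set R := [set a | A i a /\ W (iota a * unit_delta g)].
have idK : is_ideal (A i) K.
  split=> [a []|| a b [Aa Wa] [Ab Wb] | b a Ab [Aa Wa]] //.
  - by split; rewrite ?iota0 ?mul0r.
  - by split; [exact: AB | rewrite iotaD iotaN mulrBl; apply: WB].
  - split; split; [by case: (AM b a)| |by case: (AM b a)|].
      by rewrite iotaM -mulrA; case: (WM (iota b) _ _ Wa) => //; exists b.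
    have Db : D g (b * one_ g) by apply/pidealMl/ponein.
    (* a b u_g = a u_g r for this r. *)
    pose r := act (ginv g) (b * one_ g).
    have [_] := WM (iota r) _ (ex_intro2 _ _ r Logic.I erefl) Wa.
    rewrite -mulrA delta_iota mulp1; last exact: pactV_in.
    by rewrite /r pactVK // iotaM -mulrA iota_pone mulrA -iotaM.
have [K0|KA] := A_simple idK.
  right=> _ [[a /= Aa <-] Wa]; have : K a by [].
  by rewrite K0 => /= ->; rewrite iota0 mul0r.
by left=> _ [a /= Aa <-]; move: Aa; rewrite -KA => -[].
Qed.

Lemma slice_span s : exists2 m : G * 'I_n -> S,
  forall j, slice j (m j) & s = \sum_j m j.
Proof.
have [spanA _] := A_sum.
have spanA' g : exists y : 'I_n -> R, (forall i, A i (y i)) /\ s g = \sum_i y i.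
  by have [y yA sy] := spanA (s g); exists y; split=> // i; apply: yA.
have [y yP] := choice spanA'.
exists (fun j => iota (y j.1 j.2) * unit_delta j.1).
  by move=> [g i]; exists (y g i) => //=; case: (yP g).
rewrite {1}(skew_decomp s) -(pair_bigA _ (fun g i => iota (y g i) * unit_delta g)) /=.
apply: eq_bigr => g _; rewrite (yP g).2 -mulr_suml.
by rewrite (big_morph iota iotaD iota0).
Qed.

(** With [c] the inverse of the trace of 1, the right identity is [c] times the average of [f]. For
    [x] in [I], moving [x] into [f] leaves [c] times the sum of [u_g u_{g^-1} x], which is [x]. *)
Lemma skew_right_unit (I : set S) : is_invertible (trace alpha 1) ->
  is_ideal setT I -> exists2 e, I e & forall x, I x -> x * e = x.
Proof.
move=> [c [tc ct]] [_ I0 IB IM].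
have bI : is_bimod (range iota) I by split=> // b x _; apply: IM.
have [f [fI fid fD fZ]] := bimod_projection slice_bimod slice_simple slice_span bI.
exists (iota c * \sum_g unit_delta g * f (unit_delta (ginv g))).
  apply: (IM _ _ Logic.I _).1; apply: bimod_sum bI _ => g.
  exact: (IM _ _ Logic.I (fI _)).1.
(* The inverse of a central element is central. *)
have cC s : s * iota c = iota c * s.
  rewrite -[LHS]mul1r -iota1 -ct iotaM -!mulrA; congr (_ * _).
  by rewrite mulrA iota_trace_central -mulrA -iotaM tc iota1 mulr1.
move=> x Ix; rewrite mulrA cC -mulrA average_comm // => [|r y]; last first.
  by apply: fZ; exists r.
(* Each [u_{g^-1} x] lies in [I], so [f] fixes it. *)
rewrite (eq_bigr (fun g => unit_delta g * unit_delta (ginv g) * x)); last first.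
  by move=> g _; rewrite fid ?mulrA //; apply: (IM _ _ Logic.I Ix).1.
by rewrite -mulr_suml sum_delta_deltaV mulrA -iotaM ct iota1 mul1r.
Qed.

End SemisimpleBase.

End Averaging.

Theorem corollary6p14 (G : finGroupoid) (R : pzRingType)
    (alpha : unitalPartialAction G R)
    (R_semisimple : is_semisimple R)
    (trace_invertible : is_invertible (trace alpha 1%R)) :
  is_semisimple (skewRing alpha).
Proof.
have [n [A [A_ideal A_simple A_sum]]] := R_semisimple.
by apply: semisimple_right_unit => I; apply: skew_right_unit A_sum I trace_invertible.
Qed.
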